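(* Let $\mathsf{V}$ be a structurally complete congruence distributive variety of finite type generated by finite algebras, and let $\kappa > \omega$ be a regular cardinal. Then $\mathsf{V}$ is $\kappa$-structurally complete if and only if $\mathsf{V}$ is tabular, i.e. generated as a variety by a finite algebra.
   Context: All algebras are of one fixed similarity type; finite type means that it has finitely many operation symbols. A variety is generated by finite algebras if it is the smallest variety containing some class of finite algebras. A $\kappa$-quasiequation is an implication $\Gamma \Rightarrow \gamma$ where $\Gamma$ is a (possibly empty or infinite) set of fewer than $\kappa$ equations, $\gamma$ is an equation, and fewer than $\kappa$ distinct variables occur in it; it is valid in $\mathbf{A}$ if every valuation in $\mathbf{A}$ satisfying all equations of $\Gamma$ satisfies $\gamma$. A $\kappa$-quasivariety is a class defined by a set of $\kappa$-quasiequations; $\mathbf{Q}_\kappa(\mathsf{K})$ is the smallest $\kappa$-quasivariety containing $\mathsf{K}$, and $\mathbf{Q}(\mathsf{K})=\mathbf{Q}_\omega(\mathsf{K})$ is the quasivariety generated by $\mathsf{K}$. $\mathbf{F}_{\mathsf{V}}(\omega)$ is the $\mathsf{V}$-free algebra of rank $\omega$. A variety $\mathsf{V}$ is structurally complete if $\mathsf{V}=\mathbf{Q}(\mathbf{F}_{\mathsf{V}}(\omega))$, and $\kappa$-structurally complete if $\mathsf{V}=\mathbf{Q}_\kappa(\mathbf{F}_{\mathsf{V}}(\omega))$. *)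

(* Defs.v *)
From mathcomp Require Import all_boot.
From mathcomp Require Import boolp classical_sets functions cardinality.

Set Implicit Arguments.
Unset Strict Implicit.
Unset Printing Implicit Defensive.

Local Open Scope classical_set_scope.
Local Open Scope card_scope.

(* A cardinal is represented by a type [K] having that many elements. *)

Definition card_lt (T U : Type) (A : set T) (B : set U) : Prop :=
  A #<= B /\ ~ (B #<= A).

(* Fewer than K sets are always indexed by a subset of K of smaller
   cardinality, so I may range over subsets of K. *)
Definition regular_cardinal (K : Type) : Prop :=
  infinite_set [set: K] /\
  forall (I : set K) (F : K -> set K),
    card_lt I [set: K] ->
    (forall i, I i -> card_lt (F i) [set: K]) ->
    \bigcup_(i in I) F i <> [set: K].

Record signature := Signature {
  symbol : Type;
  arity : symbol -> nat
}.

Definition finite_type (S : signature) : Prop := finite_set [set: symbol S].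

(* As usual in universal algebra, carriers are nonempty. *)
Record algebra (S : signature) := Algebra {
  carrier :> Type;
  interp : forall f : symbol S, ('I_(arity f) -> carrier) -> carrier;
  carrier_inhabited : inhabited carrier
}.

Definition finite_algebra (S : signature) (A : algebra S) : Prop :=
  finite_set [set: carrier A].

Inductive term (S : signature) (X : Type) : Type :=
| Var (x : X)
| App (f : symbol S) (ts : 'I_(arity f) -> term S X).

Arguments Var {S X} x.
Arguments App {S X} f ts.

Fixpoint eval (S : signature) (X : Type) (A : algebra S) (v : X -> A)
    (t : term S X) : A :=
  match t with
  | Var x => v x
  | App f ts => interp (fun i => eval v (ts i))
  end.

Fixpoint term_vars (S : signature) (X : Type) (t : term S X) : set X :=
  match t with
  | Var x => [set x]
  | App f ts => \bigcup_i term_vars (ts i)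
  end.

Definition equation (S : signature) (X : Type) : Type :=
  (term S X * term S X)%type.

Definition equation_vars (S : signature) (X : Type) (e : equation S X) :
  set X := term_vars e.1 `|` term_vars e.2.

Definition satisfies (S : signature) (X : Type) (A : algebra S) (v : X -> A)
  (e : equation S X) : Prop := eval v e.1 = eval v e.2.

Definition valid_equation (S : signature) (X : Type) (A : algebra S)
  (e : equation S X) : Prop := forall v : X -> A, satisfies v e.

Record implication (S : signature) (X : Type) := Implication {
  premises : set (equation S X);
  conclusion : equation S X
}.

Definition implication_vars (S : signature) (X : Type)
  (q : implication S X) : set X :=
  (\bigcup_(e in premises q) equation_vars e) `|`
  equation_vars (conclusion q).

(* The variables are drawn from K itself, which supplies K many of them. *)
Definition quasiequation (S : signature) (K : Type) (q : implication S K) :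
  Prop :=
  card_lt (premises q) [set: K] /\ card_lt (implication_vars q) [set: K].

Definition valid_implication (S : signature) (X : Type) (A : algebra S)
  (q : implication S X) : Prop :=
  forall v : X -> A, (forall e, premises q e -> satisfies v e) ->
    satisfies v (conclusion q).

(* Classes are written [algebra S -> Prop] rather than [set (algebra S)]:
   [algebra S] lives one universe above the carriers, and the latter would
   force the universe of [set] above that of all carriers. *)

Definition subclass (S : signature) (C D : algebra S -> Prop) : Prop :=
  forall A, C A -> D A.

Definition same_class (S : signature) (C D : algebra S -> Prop) : Prop :=
  forall A, C A <-> D A.

Definition singleton_class (S : signature) (A : algebra S) :
  algebra S -> Prop := fun B => B = A.

(* A variety is an equational class; each equation has finitely many variables,
   so countably many variables suffice. *)
Definition variety (S : signature) (V : algebra S -> Prop) : Prop :=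
  exists E : set (equation S nat),
    forall A, V A <-> forall e, E e -> valid_equation A e.

Definition variety_generated (S : signature) (C : algebra S -> Prop) :
  algebra S -> Prop :=
  fun A => forall V, variety V -> subclass C V -> V A.

Definition generated_by_finite_algebras (S : signature)
  (V : algebra S -> Prop) : Prop :=
  exists C : algebra S -> Prop,
    subclass C (@finite_algebra S) /\ same_class V (variety_generated C).

Definition tabular (S : signature) (V : algebra S -> Prop) : Prop :=
  exists A : algebra S,
    finite_algebra A /\ same_class V (variety_generated (singleton_class A)).

Definition quasivariety (S : signature) (K : Type) (Q : algebra S -> Prop) :
  Prop :=
  exists Phi : set (implication S K),
    (forall q, Phi q -> quasiequation q) /\
    forall A, Q A <-> forall q, Phi q -> valid_implication A q.

Definition quasivariety_generated (S : signature) (K : Type)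
  (C : algebra S -> Prop) : algebra S -> Prop :=
  fun A => forall Q, quasivariety K Q -> subclass C Q -> Q A.

Definition congruence (S : signature) (A : algebra S)
  (R : A -> A -> Prop) : Prop :=
  [/\ forall x, R x x,
      forall x y, R x y -> R y x,
      forall x y z, R x y -> R y z -> R x z
    & forall (f : symbol S) (a b : 'I_(arity f) -> A),
        (forall i, R (a i) (b i)) -> R (interp a) (interp b)].

Definition congruence_meet (S : signature) (A : algebra S)
  (R T : A -> A -> Prop) : A -> A -> Prop := fun x y => R x y /\ T x y.

Definition congruence_join (S : signature) (A : algebra S)
  (R T : A -> A -> Prop) : A -> A -> Prop :=
  fun x y => forall U : A -> A -> Prop, congruence U ->
    (forall a b, R a b -> U a b) -> (forall a b, T a b -> U a b) -> U x y.

Definition congruence_distributive (S : signature) (V : algebra S -> Prop) :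
  Prop :=
  forall A : algebra S, V A ->
  forall R T U : A -> A -> Prop,
    congruence R -> congruence T -> congruence U ->
  forall x y,
    congruence_meet R (congruence_join T U) x y <->
    congruence_join (congruence_meet R T) (congruence_meet R U) x y.

(* The V-free algebra over X is the term algebra over X modulo the equations
   valid in V. An element is an equivalence class, as a predicate on terms. *)

Section FreeAlgebra.
Variables (S : signature) (V : algebra S -> Prop) (X : Type).

Definition free_eq (s t : term S X) : Prop :=
  forall A, V A -> valid_equation A (s, t).

Definition free_carrier : Type :=
  {P : term S X -> Prop | exists t, P = free_eq t}.

Definition free_class (t : term S X) : free_carrier :=
  exist _ (free_eq t) (ex_intro _ t erefl).

Definition free_repr (p : free_carrier) : term S X :=
  projT1 (cid (proj2_sig p)).

Definition free_interp (f : symbol S) (ps : 'I_(arity f) -> free_carrier) :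
  free_carrier := free_class (App f (fun i => free_repr (ps i))).

(* The algebra needs an element even if there are neither variables nor
   constants, hence the hypothesis on X. *)
Definition free_algebra (X0 : inhabited X) : algebra S :=
  Algebra free_interp
    (let: inhabits x := X0 in inhabits (free_class (Var x))).

End FreeAlgebra.

Definition free_algebra_omega (S : signature) (V : algebra S -> Prop) :
  algebra S := free_algebra V (inhabits 0%N).

Definition card_structurally_complete (S : signature) (K : Type)
  (V : algebra S -> Prop) : Prop :=
  same_class V
    (quasivariety_generated K (singleton_class (free_algebra_omega V))).

Definition structurally_complete (S : signature) (V : algebra S -> Prop) :
  Prop := card_structurally_complete nat V.

(* Main.v *)
From HB Require Import structures.
Require Import Defs.
From mathcomp Require Import all_boot.
From mathcomp Require Import boolp classical_sets functions cardinality.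
From mathcomp Require Import filter.
From Stdlib Require Import Relation_Operators Operators_Properties.

(** Jonsson terms turn an intersection of principal congruences into a visible
    inequality.  If (p, q) with p <> q lies in both Cg(a, b) and Cg(c, d), then
    some Jonsson term d_i and some translations f, g give
    d_i(f a, g c, f b) <> d_i(f a, g d, f b); this pair, called a fork below,
    again lies in both congruences.  Its depth is the number of basic steps used
    in f and in g.  In a subdirectly irreducible algebra any two pairs of
    distinct elements have a fork.

    Suppose that V is K-structurally complete with K uncountable.  A set of
    equations in countably many variables, together with one more equation,
    is then a quasiequation that transfers from the free algebra F to V, and F
    is residually finite because V is generated by finite algebras.  Applied to
    the equations that hold along an ultrafilter in a sequence of members of V,
    this yields [complete_transfers_to_finite]: a countable system of equations
    realized in an ultraproduct, together with one failing equation, is also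
    realized, with the same failure, in a finite member of V.  Two systems
    are incompatible with finiteness.

    - [bounded_fork_depth]: forks of unbounded minimal depth n in members A_n of
      V give pairs indexed by i, each obtained from the pairs of index i + 1 by
      one step, where the pairs of index i have no fork of depth below i.  The
      absence of short forks is itself a set of equations.  In a finite algebra
      two indices i < j carry the same pairs, so that the fork of depth i found
      below index i is one below index j as well: a contradiction.

    - [bounded_size]: once the depth is bounded, let A_n be subdirectly
      irreducible with many elements x_0, x_1, ...; enumerate the pairs e_t of
      distinct points, start from some pair and take forks successively with
      e_n, ..., e_1, e_0.  The last result is a pair of distinct elements that
      lies below every e_t at a depth depending on t only.  In a finite algebra
      some e_t collapses, and everything produced from it collapses as well.

    Finite type is what leaves finitely many shapes for each step, so that an
    ultrafilter can fix them.  Hence the subdirectly irreducible members of V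
    have bounded size, and V is generated by the finite algebra that is free on
    N + 1 generators for the members of size at most N + 1
    ([bounded_size_tabular]).

    Conversely, let V be generated by a finite algebra A.  A subdirectly
    irreducible member E of V with more elements than A would give, by taking
    forks of all pairs of more than |A| elements, an equation that fails in E
    but holds in A, since each valuation in A identifies two of these elements
    ([tabular_finite_irreducible]).  So E is finite; its diagram is then a
    finite set of equations, and structural completeness separates the elements
    of the critical pair of E by a homomorphism into F
    ([finite_member_separated]).  A quasiequation failing in a member of V fails
    in a subdirectly irreducible quotient of it at the critical pair, and so
    in F. *)

Set Implicit Arguments.
Unset Strict Implicit.
Unset Printing Implicit Defensive.

Local Open Scope classical_set_scope.
Local Open Scope card_scope.

(** * Homomorphisms, congruences and quotients *)
Section Algebras.
Context (S : signature).

Definition hom (A B : algebra S) (h : A -> B) : Prop :=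
  forall (f : symbol S) (a : 'I_(arity f) -> A),
    h (interp a) = interp (fun i => h (a i)).

Lemma eval_hom X (A B : algebra S) (h : A -> B) (v : X -> A) (t : term S X) :
  hom h -> h (eval v t) = eval (fun x => h (v x)) t.
Proof.
move=> hh; elim: t => [x|f ts IH] //=.
by rewrite hh; congr interp; apply: funext => i; exact: IH.
Qed.

Lemma eval_ext X (A : algebra S) (v w : X -> A) (t : term S X) :
  (forall x, term_vars t x -> v x = w x) -> eval v t = eval w t.
Proof.
elim: t => [x|f ts IH] /= vw; first exact: vw.
congr interp; apply: funext => i; apply: IH => x tx.
by apply: vw; exists i.
Qed.

(** Evaluation in this algebra is substitution. *)
Definition term_algebra X (x0 : X) : algebra S :=
  @Algebra S (term S X) (@App S X) (inhabits (Var x0)).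

Lemma hom_eval X (x0 : X) (A : algebra S) (v : X -> A) :
  @hom (term_algebra x0) A (eval v).
Proof. by []. Qed.

Lemma eval_subst X Y (y0 : Y) (A : algebra S) (w : Y -> A)
    (s : X -> term_algebra y0) (t : term S X) :
  eval w (eval s t) = eval (fun x => eval w (s x)) t.
Proof. exact: (eval_hom s t (@hom_eval _ y0 A w)). Qed.

Lemma eval_Var X (x0 : X) (t : term S X) :
  eval (A := term_algebra x0) Var t = t.
Proof.
elim: t => [x|f ts IH] //=.
by congr App; apply: funext => i; exact: IH.
Qed.

Lemma congruence_eq (A : algebra S) : @congruence S A eq.
Proof.
split=> //; first by move=> x y z -> ->.
by move=> f a b ab; congr interp; apply: funext.
Qed.

Lemma congruence_pullback (A B : algebra S) (h : A -> B) (R : B -> B -> Prop) :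
  hom h -> congruence R -> @congruence S A (fun x y => R (h x) (h y)).
Proof.
move=> hh [Rr Rs Rt Rf]; split=> //; [by move=> ? ?; exact: Rs|
  by move=> ? ? ?; exact: Rt|].
by move=> f a b ab; rewrite !hh; exact: Rf.
Qed.

Lemma congruence_bigcap (A : algebra S) I (P : I -> Prop)
    (R : I -> A -> A -> Prop) :
  (forall i, P i -> congruence (R i)) ->
  @congruence S A (fun x y => forall i, P i -> R i x y).
Proof.
move=> RP; split.
- by move=> x i /RP[].
- by move=> x y xy i Pi; have [_ Rs _ _] := RP i Pi; apply/Rs/xy.
- move=> x y z xy yz i Pi; have [_ _ Rt _] := RP i Pi.
  exact: Rt (xy i Pi) (yz i Pi).
- by move=> f a b ab i Pi; have [_ _ _ Rf] := RP i Pi; apply: Rf => j; exact: ab.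
Qed.

Lemma congruence_eval X (A : algebra S) (R : A -> A -> Prop) (v w : X -> A) t :
  congruence R -> (forall x, R (v x) (w x)) -> R (eval v t) (eval w t).
Proof.
move=> [_ _ _ Rf] vw; elim: t => [x|f ts IH] /=; first exact: vw.
exact: Rf.
Qed.

Definition set_slot T n (a : 'I_n -> T) (j : 'I_n) (x : T) : 'I_n -> T :=
  fun i => if i == j then x else a i.

(** Two tuples of arguments are joined by changing one argument at a time. *)
Lemma slotwise_congruence (A : algebra S) (R : A -> A -> Prop) :
  (forall x, R x x) -> (forall x y, R x y -> R y x) ->
  (forall x y z, R x y -> R y z -> R x z) ->
  (forall (f : symbol S) (j : 'I_(arity f)) (a : 'I_(arity f) -> A) x y,
     R x y -> R (interp (set_slot a j x)) (interp (set_slot a j y))) ->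
  congruence R.
Proof.
move=> Rr Rs Rt Rf; split=> // f a b ab.
pose c m : 'I_(arity f) -> A := fun i => if i < m then b i else a i.
have cR m : m <= arity f -> R (interp a) (interp (c m)).
  elim: m => [_|m IH mf].
    suff -> : c 0 = a by [].
    exact: funext.
  apply: Rt (IH (ltnW mf)) _.
  pose j := Ordinal mf.
  have -> : c m = set_slot (c m) j (a j).
    apply: funext => i; rewrite /c /set_slot.
    by have [->|//] := eqVneq i j; rewrite ltnn.
  have -> : c m.+1 = set_slot (c m) j (b j).
    apply: funext => i; rewrite /c /set_slot.
    have [->|ij] := eqVneq i j; first by rewrite ltnSn.
    by rewrite ltnS leq_eqVlt (negPf ij : (i == m :> nat) = false).
  exact/Rf/ab.
suff -> : b = c (arity f) by exact: cR.
by apply: funext => i; rewrite /c ltn_ord.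
Qed.

Section Quotient.
Context (A : algebra S) (R : A -> A -> Prop).

Definition quot_carrier : Type := {P : A -> Prop | exists x, P = R x}.

Definition quot_class (x : A) : quot_carrier :=
  exist _ (R x) (ex_intro _ x erefl).

Definition quot_repr (p : quot_carrier) : A := projT1 (cid (proj2_sig p)).

Definition quot_interp (f : symbol S) (ps : 'I_(arity f) -> quot_carrier) :
  quot_carrier := quot_class (interp (fun i => quot_repr (ps i))).

Definition quot_algebra : algebra S :=
  Algebra quot_interp
    (let: inhabits x := carrier_inhabited A in inhabits (quot_class x)).

Lemma quot_reprK (p : quot_carrier) : quot_class (quot_repr p) = p.
Proof.
rewrite /quot_repr; case: p => P Pp /=; case: cid => x /= Px; move: Pp.
by rewrite Px => Pp; congr exist; exact: Prop_irrelevance.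
Qed.

Lemma quot_class_eq x y : congruence R ->
  quot_class x = quot_class y <-> R x y.
Proof.
move=> [Rr Rs Rt _]; split=> [/(congr1 (@proj1_sig _ _)) /= ->//|Rxy].
suff E : R x = R y.
  by rewrite /quot_class; move: (ex_intro _ x _) (ex_intro _ y _);
     rewrite E => H1 H2; congr exist; exact: Prop_irrelevance.
apply: funext => z; apply: propext; split=> H; last exact: Rt H.
by apply: Rt H; exact: Rs.
Qed.

Lemma hom_quot_class : congruence R -> @hom A quot_algebra quot_class.
Proof.
move=> cR f a; apply/(quot_class_eq _ _ cR).
have [_ _ _ Rf] := cR; apply: Rf => i.
by apply/(quot_class_eq _ _ cR); rewrite quot_reprK.
Qed.

Lemma variety_quot (V : algebra S -> Prop) : variety V -> congruence R ->
  (forall e : equation S nat, (forall B, V B -> valid_equation B e) ->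
    forall s : nat -> A, R (eval s e.1) (eval s e.2)) ->
  V quot_algebra.
Proof.
move=> [E VE] cR RE; apply/VE => e Ee v.
have -> : v = (fun n => quot_class (quot_repr (v n))).
  by apply: funext => n; rewrite quot_reprK.
rewrite /satisfies -!(eval_hom _ _ (hom_quot_class cR)).
by apply/(quot_class_eq _ _ cR)/RE => B /VE; exact.
Qed.

End Quotient.

Lemma variety_quot_member (V : algebra S -> Prop) (A : algebra S)
    (R : A -> A -> Prop) :
  variety V -> congruence R -> V A -> V (quot_algebra R).
Proof.
move=> vV cR VA; apply: variety_quot => // e Ve s.
by have [Rr _ _ _] := cR; rewrite (Ve A VA s).
Qed.

(** Zorn's lemma.  The sets of pairs are completed by the diagonal so that the
    union of the empty chain is a congruence too. *)
Lemma maximal_congruence (A : algebra S) (p q : A) : p <> q ->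
  exists R : A -> A -> Prop, [/\ congruence R, ~ R p q &
    forall T : A -> A -> Prop, congruence T ->
      (forall x y, R x y -> T x y) -> ~ T p q -> forall x y, T x y -> R x y].
Proof.
move=> pq.
pose rel_of (X : set (A * A)) x y := x = y \/ X (x, y).
pose P (X : set (A * A)) := congruence (rel_of X) /\ ~ X (p, q).
have [|X [[cX Xpq] Xmax]] := @Zorn_bigcup _ P.
  move=> F FP Ftot; split; last by move=> [X /FP[_]].
  have Fr1 X x y : F X -> rel_of X x y -> rel_of (\bigcup_(X in F) X) x y.
    by move=> FX [|Xxy]; [left|right; exists X].
  have Fr x y : rel_of (\bigcup_(X in F) X) x y ->
      x = y \/ exists2 X, F X & rel_of X x y.
    by move=> [|[X FX Xxy]]; [left|right; exists X => //; right].
  apply: slotwise_congruence.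
  - by move=> x; left.
  - move=> x y /Fr[->|[X FX Xxy]]; first by left.
    by have [[_ Xs _ _] _] := FP X FX; apply: Fr1 FX _; exact: Xs.
  - move=> x y z /Fr[->//|[X FX Xxy]] /Fr[<-|[Y FY Yyz]]; first exact: Fr1 Xxy.
    have lift (X' Y' : set (A * A)) a b : X' `<=` Y' -> rel_of X' a b -> rel_of Y' a b.
      by move=> XY [->|/XY]; [left|right].
    have [XY|YX] := Ftot _ _ FX FY.
      have [[_ _ Yt _] _] := FP Y FY; apply: Fr1 FY _; apply: Yt Yyz.
      exact: lift Xxy.
    have [[_ _ Xt _] _] := FP X FX; apply: Fr1 FX _; apply: Xt Xxy _.
    exact: lift Yyz.
  - move=> f j a x y /Fr[->|[X FX Xxy]]; first by left.
    have [[Xr _ _ Xf] _] := FP X FX; apply: Fr1 FX _; apply: Xf => i.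
    by rewrite /set_slot; case: eqP.
exists (rel_of X); split=> //; first by case.
move=> T cT XT Tpq x y Txy; apply: contrapT => Xxy.
have ET : rel_of [set u | T u.1 u.2] = T.
  apply: funext => a; apply: funext => b; apply: propext; split=> [[->|//]|]; last by right.
  by have [Tr _ _ _] := cT.
apply: (Xmax [set u | T u.1 u.2]); last by split=> //; rewrite ET.
split=> [[a b] Xab|XTe]; first by apply: XT; right.
by apply: Xxy; right; exact: (XTe (x, y)).
Qed.

(** Subdirect irreducibility with a chosen critical pair (p, q), that is, a pair
    generating the monolith. *)
Definition subdirectly_irreducible (A : algebra S) (p q : A) : Prop :=
  p <> q /\ forall T : A -> A -> Prop, congruence T ->
    forall a b, a <> b -> T a b -> T p q.

Lemma subdirectly_irreducible_quotient (A : algebra S) (p q : A) : p <> q ->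
  exists R : A -> A -> Prop, congruence R /\
    @subdirectly_irreducible (quot_algebra R) (quot_class R p) (quot_class R q).
Proof.
move=> /maximal_congruence[R [cR Rpq Rmax]]; exists R; split=> //.
split; first by move/(quot_class_eq _ _ cR).
move=> T cT a b ab Tab; apply: contrapT => Tpq.
apply: ab; rewrite -(quot_reprK a) -(quot_reprK b); apply/(quot_class_eq _ _ cR).
apply: (Rmax (fun x y => T (quot_class R x) (quot_class R y))) => //.
- exact: (congruence_pullback (hom_quot_class cR) cT).
- by move=> x y /(quot_class_eq _ _ cR) ->; have [Tr _ _ _] := cT; exact: Tr.
- by rewrite !quot_reprK.
Qed.

End Algebras.

(** * Free algebras and Jonsson terms *)
Section FreeAlgebras.
Context (S : signature) (V : algebra S -> Prop).

Lemma congruence_free_eq X (x0 : X) :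
  @congruence S (term_algebra S x0) (@free_eq S V X).
Proof.
split=> //.
- by move=> s t st A VA v; exact/esym/st.
- by move=> r s t rs st A VA v; exact: etrans (rs A VA v) (st A VA v).
- move=> f a b ab A VA v; rewrite /satisfies /=.
  by congr interp; apply: funext => i; exact: ab.
Qed.

Lemma free_class_eq X (x0 : X) (s t : term S X) :
  free_class V s = free_class V t <-> free_eq V s t.
Proof. exact: (@quot_class_eq S (term_algebra S x0) _ s t (@congruence_free_eq X x0)). Qed.

Lemma free_reprK X (x0 : X) (p : free_carrier V X) :
  free_class V (free_repr p) = p.
Proof. exact: (@quot_reprK S (term_algebra S x0) _ p). Qed.

Lemma hom_free_class X (x0 : X) :
  @hom S (term_algebra S x0) (free_algebra V (inhabits x0)) (@free_class S V X).
Proof. exact: (@hom_quot_class S (term_algebra S x0) _ (@congruence_free_eq X x0)). Qed.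

Lemma eval_free_repr X (x0 : X) (A : algebra S) (v : X -> A) t :
  V A -> eval v (free_repr (free_class V t)) = eval v t.
Proof. by move=> VA; have /(free_class_eq x0) := free_reprK x0 (free_class V t); apply. Qed.

Lemma hom_eval_free_repr X (x0 : X) (A : algebra S) (v : X -> A) : V A ->
  @hom S (free_algebra V (inhabits x0)) A (fun p => eval v (free_repr p)).
Proof. by move=> VA f a; rewrite /= (eval_free_repr x0). Qed.

End FreeAlgebras.

(** An algebra that is free for a subclass [W] only is needed for the finite
    generator of a tabular variety. *)
Lemma variety_free_algebra (S : signature) (V W : algebra S -> Prop) X (x0 : X) :
  variety V -> subclass W V -> V (free_algebra W (inhabits x0)).
Proof.
move=> vV WV.
suff : V (quot_algebra (@free_eq S W X : term_algebra S x0 -> _ -> Prop)) by [].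
apply: variety_quot (congruence_free_eq _ _) _ => // e Ve s A WA v.
by rewrite /satisfies /= !eval_subst; exact: Ve (WV _ WA) _.
Qed.

(** The valuation of a ternary term; variables beyond the third are given the
    third value, so that every term over [nat] is treated as ternary. *)
Definition triple T (x y z : T) : nat -> T :=
  fun n => match n with 0 => x | 1 => y | _ => z end.

Lemma triple_comp T U (h : T -> U) (x y z : T) :
  (fun n => h (triple x y z n)) = triple (h x) (h y) (h z).
Proof. by apply: funext => -[|[|n]]. Qed.

(** Less than a Jonsson sequence: only the identity d(x, y, x) = x and the fact
    that two distinct elements u, v are told apart by some d(u, -, v). *)
Definition jonsson_terms (S : signature) (V : algebra S -> Prop) m
    (J : 'I_m -> term S nat) : Prop :=
  forall A : algebra S, V A ->
    (forall i (x y : A), eval (triple x y x) (J i) = x) /\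
    (forall u v : A,
      (forall i, eval (triple u u v) (J i) = eval (triple u v v) (J i)) -> u = v).

Section JonssonTerms.
Context (S : signature) (V : algebra S -> Prop).

Let F := free_algebra_omega V.

(** The kernel, on the free algebra, of the substitution of variables [r]. *)
Let ker (r : nat -> nat) (p q : F) : Prop :=
  forall i : {A : algebra S & nat -> A}, V (projT1 i) ->
    eval (fun n => projT2 i (r n)) (free_repr p) =
    eval (fun n => projT2 i (r n)) (free_repr q).

Let congruence_ker r : @congruence S F (ker r).
Proof.
apply: congruence_bigcap => -[A v] /= VA.
exact: (@congruence_pullback S F A _ _
  (@hom_eval_free_repr _ V nat 0 A (fun n => v (r n)) VA) (@congruence_eq S A)).
Qed.

(** Let al, be, ga be the kernels of (x, y, z) |-> (x, y, x), (x, x, z),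
    (x, z, z) on F.  Then (x, z) lies in al /\ (be \/ ga), hence by
    distributivity in (al /\ be) \/ (al /\ ga); the terms on a chain that
    witnesses this have the required properties. *)
Lemma exists_jonsson_terms : variety V -> congruence_distributive V ->
  exists m (J : 'I_m -> term S nat), jonsson_terms V J.
Proof.
move=> vV cdV; have VF : V F by exact: variety_free_algebra.
pose al := ker (triple 0 1 0); pose be := ker (triple 0 0 1).
pose ga := ker (triple 0 1 1).
pose link p q := al p q /\ (be p q \/ ga p q).
have [[ar as_ at_ af] [br bs bt bf] [gr gs gt gf]] :
  [/\ congruence al, congruence be & congruence ga] by split; exact: congruence_ker.
have cchain : congruence (clos_refl_trans F link).
  apply: slotwise_congruence.
  - exact: rt_refl.
  - move=> x y; elim=> [a b [ab1 ab2]|a|a b c _ ba _ cb]; last exact: rt_trans cb ba.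
      by apply: rt_step; split; [exact: as_|case: ab2 => ?; [left; exact: bs|right; exact: gs]].
    exact: rt_refl.
  - by move=> x y z; exact: rt_trans.
  - move=> f j a x y; elim=> [c d [cd1 cd2]|c|c d e _ cd _ de]; last exact: rt_trans cd de.
      apply: rt_step; split; [apply: af|case: cd2 => cd; [left; apply: bf|right; apply: gf]];
      by move=> i; rewrite /set_slot; case: eqP.
    exact: rt_refl.
have : clos_refl_trans F link (free_class V (Var 0)) (free_class V (Var 2)).
  have [cd _] := cdV F VF al be ga (congruence_ker _) (congruence_ker _)
    (congruence_ker _) (free_class V (Var 0)) (free_class V (Var 2)).
  have /cd : congruence_meet al (congruence_join be ga)
      (free_class V (Var 0)) (free_class V (Var 2)).
    split; first by move=> [A v] VA; rewrite !(eval_free_repr 0).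
    move=> U [_ _ Ut _] bU gU; apply: (Ut _ (free_class V (Var 1))).
      by apply: bU => -[A v] VA; rewrite !(eval_free_repr 0).
    by apply: gU => -[A v] VA; rewrite !(eval_free_repr 0).
  by move=> /(_ _ cchain); apply=> a b [ab1 ab2]; apply: rt_step; split=> //; [left|right].
move=> /(clos_rt_rt1n F link).
pose val (t : F) (A : algebra S) (x y z : A) := eval (triple x y z) (free_repr t).
have [p0 p0E] : exists p0, p0 = free_class V (Var 0) :> F by eexists.
have [p2 p2E] : exists p2, p2 = free_class V (Var 2) :> F by eexists.
rewrite -p0E -p2E => chain.
have chain_list x z : clos_refl_trans_1n F link x z -> al p0 x ->
    exists L : seq F, (forall i, i < size L -> al p0 (nth p0 L i)) /\
      forall A : algebra S, V A -> forall u v : A,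
        (forall i, i < size L ->
           val (nth p0 L i) A u u v = val (nth p0 L i) A u v v) ->
        val x A u u v = val z A u u v.
  elim=> [{}x|{}x y {}z [xy1 xy2] _ IH] p0x; first by exists [::].
  have [L [Lal Lval]] := IH (at_ _ _ _ p0x xy1).
  exists [:: x, y & L]; split=> [[|[|i]] //= iL|A VA u v Lh] /=.
  - exact: at_ p0x xy1.
  - exact: Lal.
  rewrite -(Lval A VA u v); last by move=> i iL; exact: (Lh i.+2).
  case: xy2 => [/(_ (existT _ A (triple u v v)))|/(_ (existT _ A (triple u v v)))] /(_ VA) /=;
    rewrite triple_comp // => xy.
  by rewrite [LHS](Lh 0) // [RHS](Lh 1).
have [L [Lal Lval]] := chain_list _ _ chain (ar p0).
exists (size L), (fun i => free_repr (nth p0 L i)) => A VA; split=> [i x y|u v uv].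
  have := Lal i (ltn_ord i) (existT _ A (triple x y x)) VA.
  by rewrite /= triple_comp /= => <-; rewrite p0E (eval_free_repr 0).
have := Lval A VA u v (fun i iL => uv (Ordinal iL)).
by rewrite /val p0E p2E !(eval_free_repr 0).
Qed.

End JonssonTerms.

(** Variable 0 is the hole of a one-hole term, the others are parameters. *)
Definition at_hole T (x : T) (par : nat -> T) : nat -> T :=
  fun n => if n is k.+1 then par k else x.

(** A step is a one-hole term.  Besides the basic translations, the identity is
    included, so that depths can be padded, and d(p, -, q) for each Jonsson term
    d: its hole may be repeated, so that it need not be a composite of basic
    translations. *)
Definition enough_steps (S : signature) m (J : 'I_m -> term S nat) Z
    (term_of : Z -> term S nat) : Prop :=
  [/\ exists z, term_of z = Var 0,
      forall (f : symbol S) (j : 'I_(arity f)), exists z,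
        term_of z = App f (set_slot (fun i : 'I_(arity f) => Var i.+1) j (Var 0))
    & forall i, exists z,
        term_of z = eval (A := term_algebra S 0) (triple (Var 1) (Var 0) (Var 2)) (J i)].

Lemma card_le_injection T (A : set T) (U : Type) (B : set U) (u0 : U) :
  A #<= B -> exists f : T -> U, {in A &, injective f} /\ forall x, A x -> B (f x).
Proof.
pose U' := HB.pack_for pointedType U (gen_eqMixin U) (gen_choiceMixin U)
  (isPointed.Build U u0).
move=> /(@pcard_leP T U' A B)[f]; exists f; split; first exact: 'inj_f.
by move=> x /'funS_f.
Qed.

Lemma finite_setT_surjection T : finite_set [set: T] ->
  exists (I : finType) (c : I -> T), forall x, exists i, c i = x.
Proof.
move=> /finite_set_leP[n] /(card_le_injection 0)[f [finj fn]].
pose I := {i : 'I_n | `[<exists x, f x = i>]}.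
exists I, (fun i : I => projT1 (cid (asboolW (svalP i)))) => x.
have xP : `[<exists y, f y = Ordinal (fn x Logic.I)>] by apply/asboolP; exists x.
exists (exist (fun i : 'I_n => `[<exists y, f y = i>]) _ xP).
case: cid => /= y yx.
by apply: finj; rewrite ?inE.
Qed.

(** Finite type enters here: finitely many symbols make finitely many steps. *)
Lemma exists_enough_steps (S : signature) m (J : 'I_m -> term S nat) :
  finite_type S -> exists (Z : finType) (term_of : Z -> term S nat), enough_steps J term_of.
Proof.
move=> /finite_setT_surjection[I [c cP]].
exists (option ({i : I & 'I_(arity (c i))} + 'I_m)%type).
exists (fun z => match z with
  | None => Var 0
  | Some (inl (existT i j)) =>
      App (c i) (set_slot (fun l : 'I_(arity (c i)) => Var l.+1) j (Var 0))
  | Some (inr i) =>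
      eval (A := term_algebra S 0) (triple (Var 1) (Var 0) (Var 2)) (J i)
  end); split.
- by exists None.
- move=> f; have [i <-] := cP f => j.
  by exists (Some (inl (existT _ i j))).
- by move=> i; exists (Some (inr i)).
Qed.

(** * Translations and forks *)
Section Translations.
Context (S : signature) (m : nat) (J : 'I_m -> term S nat).
Context (Z : Type) (term_of : Z -> term S nat).
Implicit Types (A B : algebra S).

Definition step A (z : Z) (par : nat -> A) (x : A) : A :=
  eval (at_hole x par) (term_of z).

(** Shapes and parameters are indexed by position, the innermost step first,
    and only the first [k] of them matter.  Shapes come from a fixed set that
    does not mention the algebra, so they can be compared across algebras. *)
Fixpoint translate A k (zs : nat -> Z) (par : nat -> nat -> A) (x : A) : A :=
  if k is k'.+1 then step (zs k') (par k') (translate k' zs par x) else x.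

Definition jonsson A i (x y z : A) : A := eval (triple x y z) (J i).

Lemma hom_step A B (h : A -> B) z par x : hom h ->
  h (step z par x) = step z (fun j => h (par j)) (h x).
Proof.
move=> hh; rewrite /step (eval_hom _ _ hh); congr eval.
by apply: funext => -[].
Qed.

Lemma hom_translate A B (h : A -> B) k zs par x : hom h ->
  h (translate k zs par x) = translate k zs (fun i j => h (par i j)) (h x).
Proof. by move=> hh; elim: k => //= k IH; rewrite (hom_step _ _ _ hh) IH. Qed.

Lemma hom_jonsson A B (h : A -> B) i x y z : hom h ->
  h (jonsson i x y z) = jonsson i (h x) (h y) (h z).
Proof. by move=> hh; rewrite /jonsson (eval_hom _ _ hh) triple_comp. Qed.

Lemma congruence_jonsson A (R : A -> A -> Prop) i x y z x' y' z' :
  congruence R -> R x x' -> R y y' -> R z z' ->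
  R (jonsson i x y z) (jonsson i x' y' z').
Proof. by move=> cR xx yy zz; apply: congruence_eval => // -[|[|]]. Qed.

Lemma translate_ext A k zs zs' (par par' : nat -> nat -> A) x :
  (forall i, i < k -> zs i = zs' i) -> (forall i, i < k -> par i = par' i) ->
  translate k zs par x = translate k zs' par' x.
Proof.
elim: k => //= k IH zz pp; rewrite zz // pp // IH // => i ik.
  by apply: zz; exact: ltnW.
by apply: pp; exact: ltnW.
Qed.

Lemma translate_add A k l zs (par : nat -> nat -> A) x :
  translate (k + l) zs par x =
  translate l (fun i => zs (k + i)) (fun i => par (k + i)) (translate k zs par x).
Proof. by elim: l => [|l IH]; rewrite ?addn0 // addnS /= IH. Qed.

Definition cat_at T k (u v : nat -> T) : nat -> T :=
  fun i => if i < k then u i else v (i - k).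

Lemma translate_cat A k l zs zs' (par par' : nat -> nat -> A) x :
  translate (k + l) (cat_at k zs zs') (cat_at k par par') x =
  translate l zs' par' (translate k zs par x).
Proof.
rewrite translate_add (@translate_ext _ k _ zs _ par); first last.
- by move=> i ik; rewrite /cat_at ik.
- by move=> i ik; rewrite /cat_at ik.
by apply: translate_ext => i _; rewrite /cat_at ltnNge leq_addr /= addKn.
Qed.

Definition is_translation A k (h : A -> A) : Prop :=
  exists zs par, forall x, h x = translate k zs par x.

Lemma is_translation_comp A k l (h g : A -> A) :
  is_translation k h -> is_translation l g ->
  is_translation (k + l) (fun x => g (h x)).
Proof.
move=> [zs [par hE]] [zs' [par' gE]].
exists (cat_at k zs zs'), (cat_at k par par') => x.
by rewrite translate_cat hE gE.
Qed.

Lemma is_translation_step A z par : @is_translation A 1 (step z par).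
Proof. by exists (fun=> z), (fun=> par). Qed.

(** [T s] is the pair of values on side [s].  The two values
    d(a, c, b) and d(a, d', b), for (a, b) on one side and (c, d') on the other,
    are congruent modulo either pair. *)
Definition fork A i (T : bool -> bool -> A) : bool -> A :=
  fun e => jonsson i (T false false) (T true e) (T false true).

Definition has_fork A k (P : bool -> bool -> A) : Prop :=
  exists (zs : bool -> nat -> Z) (par : bool -> nat -> nat -> A) i,
    let T s e := translate k (zs s) (par s) (P s e) in
    fork i T false <> fork i T true.

Lemma has_forkP A k (P : bool -> bool -> A) :
  has_fork k P <-> exists (h : bool -> A -> A) i,
    (forall s, is_translation k (h s)) /\
    fork i (fun s e => h s (P s e)) false <> fork i (fun s e => h s (P s e)) true.
Proof.
split=> [[zs [par [i Hi]]]|[h [i [hk Hi]]]].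
  exists (fun s => translate k (zs s) (par s)), i; split=> // s.
  by exists (zs s), (par s).
have [zsf [parf Ef]] := hk false; have [zst [part Et]] := hk true.
exists (fun s => if s then zst else zsf), (fun s => if s then part else parf), i.
by move: Hi; rewrite /fork /= !Et !Ef.
Qed.

Hypothesis steps : enough_steps J term_of.

Lemma is_translation_id A k : @is_translation A k id.
Proof.
have [[z zE] _ _] := steps.
exists (fun=> z), (fun _ _ => inhabited_witness (carrier_inhabited A)) => x.
by elim: k => //= k <-; rewrite /step zE.
Qed.

Lemma is_translation_leq A k l (h : A -> A) : k <= l ->
  is_translation k h -> is_translation l h.
Proof.
move=> /subnKC <- hk.
exact: (is_translation_comp hk (@is_translation_id A (l - k))).
Qed.

Lemma is_translation_set_slot A (f : symbol S) (j : 'I_(arity f)) a :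
  @is_translation A 1 (fun x => interp (set_slot a j x)).
Proof.
have [_ /(_ f j)[z zE] _] := steps.
pose par k := if insub k is Some i then a i else a j.
suff -> : (fun x => interp (set_slot a j x)) = step z par by exact: is_translation_step.
apply: funext => x; rewrite /step zE /=; congr interp; apply: funext => i.
rewrite /set_slot; case: eqP => // _ /=.
by rewrite /par insubT //= => iL; congr a; apply: val_inj.
Qed.

Lemma is_translation_jonsson A i (p q : A) :
  is_translation 1 (fun x => jonsson i p x q).
Proof.
have [_ _ /(_ i)[z zE]] := steps.
pose par k := if k == 0 then p else q.
suff -> : (fun x => jonsson i p x q) = step z par by exact: is_translation_step.
apply: funext => x; rewrite /step zE eval_subst /jonsson; congr eval.
by apply: funext => -[|[|]].
Qed.

(** Closing under all translations makes an equivalence compatible with the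
    operations; this replaces chains of translations as a description of
    principal congruences. *)
Lemma congruence_translations A I (g : I -> A -> A) :
  congruence (fun x y => forall k h i, is_translation k h -> g i (h x) = g i (h y)).
Proof.
apply: slotwise_congruence => //.
- by move=> x y xy k h i hk; rewrite (xy k h i).
- by move=> x y z xy yz k h i hk; rewrite (xy k h i) // (yz k h i).
- move=> f j a x y xy k h i hk.
  apply: (xy (1 + k) (fun x => h (interp (set_slot a j x)))).
  exact: is_translation_comp (is_translation_set_slot _ _) hk.
Qed.

Lemma has_fork_leq A k l (P : bool -> bool -> A) : k <= l ->
  has_fork k P -> has_fork l P.
Proof.
move=> kl /has_forkP[h [i [hk hi]]]; apply/has_forkP; exists h, i; split=> // s.
exact: is_translation_leq kl (hk s).
Qed.

Lemma has_fork_translate A k l zs par (P : bool -> bool -> A) :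
  has_fork l (fun s e => translate k (zs s) (par s) (P s e)) -> has_fork (k + l) P.
Proof.
move=> [zs' [par' [i Hi]]].
exists (fun s => cat_at k (zs s) (zs' s)), (fun s => cat_at k (par s) (par' s)), i.
by rewrite /fork !translate_cat.
Qed.

Context (V : algebra S -> Prop) (jonssonJ : jonsson_terms V J).

Lemma jonsson_idem A : V A -> forall i (x y : A), jonsson i x y x = x.
Proof. by move=> /jonssonJ[]. Qed.

Lemma jonsson_neq A (x y : A) : V A -> x <> y ->
  exists i, jonsson i x x y <> jonsson i x y y.
Proof.
move=> VA xy; apply: contrapT => /forallNP noi; apply: xy.
by have [_] := jonssonJ VA; apply=> i; exact: contrapT (noi i).
Qed.

(** As d(p, p, q) and d(p, q, q) differ for some Jonsson term d, and p, q are
    congruent modulo the first pair (a, b), some translation h makes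
    u = d(p, h a, q) and w = d(p, h b, q) differ.  Both are congruent to p modulo
    Cg(p, q), hence modulo the second pair; so the same argument applies to
    (u, w) and the second pair, and its outcome is a fork. *)
Lemma common_pair_has_fork A (P : bool -> bool -> A) (p q : A) :
  V A -> p <> q ->
  (forall s (R : A -> A -> Prop), congruence R -> R (P s false) (P s true) -> R p q) ->
  exists k, has_fork k P.
Proof.
move=> VA pq Ppq; have [i pqi] := jonsson_neq VA pq.
have [k [h [hk]]] : exists k h, is_translation k h /\
    jonsson i p (h (P false false)) q <> jonsson i p (h (P false true)) q.
  apply: contrapT => noh; apply: pqi.
  apply: (Ppq false _ (congruence_translations (fun _ : unit => fun x => jonsson i p x q))
    _ 0 id tt (is_translation_id _ _)) => k h _ hk.
  by apply: contrapT => hi; apply: noh; exists k, h.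
set u := jonsson i _ _ _; set w := jonsson i _ _ _ => uw.
have [l [g [i' [gl gi']]]] : exists l g i', is_translation l g /\
    jonsson i' u (g (P true false)) w <> jonsson i' u (g (P true true)) w.
  apply: contrapT => nog; apply: uw.
  (* If no fork existed, this congruence would contain the second pair. *)
  pose R := fun x y : A => forall k h i, is_translation k h ->
    jonsson i u (h x) w = jonsson i u (h y) w.
  have cR : congruence R := congruence_translations (fun i => fun x => jonsson i u x w).
  have [Rr Rs Rt _] := cR.
  have Rpq : R p q.
    apply: (Ppq true R cR) => l g i' gl.
    by apply: contrapT => gi'; apply: nog; exists l, g, i'.
  have Rp y : R (jonsson i p y q) p.
    rewrite -[X in R _ X](jonsson_idem VA i p y).
    exact: (congruence_jonsson i cR (Rr p) (Rr y) (Rs _ _ Rpq)).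
  apply: contrapT => uw; have [i' []] := jonsson_neq VA uw.
  by apply: (Rt u p w (Rp _) (Rs _ _ (Rp _)) 0 id) => //; exact: is_translation_id.
exists (maxn (k + 1) l); apply/has_forkP.
exists (fun s : bool => if s then g else fun x => jonsson i p (h x) q), i'; split=> //.
case; first exact: is_translation_leq (leq_maxr _ _) gl.
apply: is_translation_leq (leq_maxl _ _) _.
exact: is_translation_comp hk (is_translation_jonsson _ _ _).
Qed.

Lemma subdirectly_irreducible_has_fork A (p q : A) (P : bool -> bool -> A) :
  V A -> subdirectly_irreducible p q ->
  (forall s, P s false <> P s true) -> exists k, has_fork k P.
Proof.
move=> VA [pq SI] Pne; apply: common_pair_has_fork VA pq _ => s R cR.
exact: SI.
Qed.

Lemma fork_collapse A i (T : bool -> bool -> A) s : V A ->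
  T s false = T s true -> fork i T false = fork i T true.
Proof. by move=> VA; case: s; rewrite /fork => ->//; rewrite !jonsson_idem. Qed.

End Translations.

(** * Renaming variables; quasiequations in countably many variables *)
Section Renaming.
Context (S : signature) (X Y : Type) (y0 : Y) (j : X -> Y).

Definition rename (t : term S X) : term S Y :=
  eval (A := term_algebra S y0) (fun x => Var (j x)) t.

Definition rename_equation (e : equation S X) : equation S Y :=
  (rename e.1, rename e.2).

Lemma eval_rename (A : algebra S) (w : Y -> A) t :
  eval w (rename t) = eval (fun x => w (j x)) t.
Proof. exact: eval_subst. Qed.

Lemma satisfies_rename (A : algebra S) (w : Y -> A) e :
  satisfies w (rename_equation e) <-> satisfies (fun x => w (j x)) e.
Proof. by rewrite /satisfies /= !eval_rename. Qed.

Lemma term_vars_rename t : term_vars (rename t) `<=` range j.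
Proof.
elim: t => [x|f ts IH] /= y; first by move=> ->; exists x.
by move=> [i _]; exact: IH.
Qed.

Lemma equation_vars_rename e : equation_vars (rename_equation e) `<=` range j.
Proof. by move=> y [|]; exact: term_vars_rename. Qed.

Lemma extend_valuation (A : algebra S) (v : X -> A) : injective j ->
  exists w : Y -> A, (fun x => w (j x)) = v.
Proof.
move=> jinj; have [a0] := carrier_inhabited A.
exists (fun y => if pselect (exists x, j x = y) is left H then v (projT1 (cid H)) else a0).
apply: funext => x; case: pselect => [H|[]]; last by exists x.
by case: cid => /= x' /jinj ->.
Qed.

Lemma valid_implication_rename (A : algebra S) (G : set (equation S X)) g :
  injective j ->
  valid_implication A (Implication (rename_equation @` G) (rename_equation g)) <->
  valid_implication A (Implication G g).
Proof.
move=> jinj; split=> H v vG /=.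
  have [w wv] := extend_valuation v jinj; rewrite -wv.
  apply/satisfies_rename/H => _ [e Ge <-].
  by apply/satisfies_rename; rewrite wv; exact: vG.
apply/satisfies_rename/H => e Ge; apply/satisfies_rename/vG.
by exists e.
Qed.

End Renaming.

Lemma finite_term_vars (S : signature) X (t : term S X) : finite_set (term_vars t).
Proof.
elim: t => [x|f ts IH] /=; first exact: finite_set1.
by apply: bigcup_finite => //; exact: finite_finset.
Qed.

Lemma variety_equation (S : signature) (e : equation S nat) :
  variety (fun A => valid_equation A e).
Proof. by exists [set e] => A; split=> [Ae _ -> //|]; exact. Qed.

(** Varieties are defined by equations over [nat]; since an equation has
    finitely many variables, it can be renamed into [nat] and back. *)
Lemma valid_equation_generated (S : signature) X (C : algebra S -> Prop)
    (e : equation S X) (B : algebra S) :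
  (forall A, C A -> valid_equation A e) -> variety_generated C B ->
  valid_equation B e.
Proof.
move=> Ce CB v.
have [f finj] : exists f : X -> nat, {in equation_vars e &, injective f}.
  apply/countable_injP/finite_set_countable.
  by rewrite finite_setU; split; exact: finite_term_vars.
have [b0] := carrier_inhabited B.
pose w n := if pselect (exists2 x, equation_vars e x & f x = n) is left H
  then v (s2val (cid2 H)) else b0.
have Ee : eval v e.1 = eval (fun x => w (f x)) e.1 /\
    eval v e.2 = eval (fun x => w (f x)) e.2.
  split; apply: eval_ext => x ex; rewrite /w; case: pselect => [H|[]].
  - by case: cid2 => /= y ey /finj ->//; rewrite inE //; left.
  - by exists x => //; left.
  - by case: cid2 => /= y ey /finj ->//; rewrite inE //; right.
  - by exists x => //; right.
rewrite /satisfies Ee.1 Ee.2; apply/(satisfies_rename 0 f w e).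
apply: (CB _ (variety_equation (rename_equation 0 f e))) => A CA u.
exact/satisfies_rename/Ce.
Qed.

Lemma variety_generated_self (S : signature) (C : algebra S -> Prop) :
  subclass C (variety_generated C).
Proof. by move=> A CA W _; exact. Qed.

Lemma countable_terms (S : signature) (X : countType) : finite_type S ->
  countable [set: term S X].
Proof.
move=> /finite_set_countable/countable_injP[c cinj].
pose enc := fix enc (t : term S X) : GenTree.tree X := match t with
  | Var x => GenTree.Leaf x
  | App f ts => GenTree.Node (c f) [seq enc (ts i) | i <- enum 'I_(arity f)]
  end.
apply/countable_injP; exists (fun t => pickle (enc t)).
move=> s t _ _ /(pcan_inj (@pickleK _)).
elim: s t => [x|f ss IH] [y|g ts] //=; first by move=> [->].
move=> [/cinj fg]; have {}fg : f = g by apply: fg; rewrite inE.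
case: _ / fg ts => ts /eq_in_map st; congr App; apply: funext => i.
by apply/IH/st; rewrite mem_enum.
Qed.

Section Uncountable.
Context (S : signature) (K : Type).
Hypothesis uncountableK : card_lt [set: nat] [set: K].

Lemma uncountable_embedding (X : countType) : exists j : X -> K, injective j.
Proof.
have [+ notK] := uncountableK.
have [k0] : inhabited K.
  apply: contrapT => noK; apply: notK; apply: card_le_trans (card_ge0 _ [set: nat]).
  by apply: subset_card_le => x; case: noK.
move=> /(card_le_injection k0)[f [finj _]].
exists (fun x => f (pickle x)) => x y /finj; rewrite !inE => /(_ I I).
exact: (pcan_inj (@pickleK _)).
Qed.

Lemma countable_card_lt T (A : set T) : countable A -> card_lt A [set: K].
Proof.
have [leK notK] := uncountableK; move=> cA; split; first exact: card_le_trans cA leK.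
by move=> KA; apply: notK; exact: card_le_trans KA cA.
Qed.

Lemma quasiequation_rename (X : countType) (j : X -> K) (k0 : K)
    (G : set (equation S X)) g : finite_type S ->
  quasiequation (Implication (rename_equation k0 j @` G) (rename_equation k0 j g)).
Proof.
move=> finS; split; apply: countable_card_lt.
  apply: sub_countable (card_image_le _ _) _.
  apply: (@sub_countable _ _ _ ([set: term S X] `*` [set: term S X])).
    exact: subset_card_le.
  by apply: countableX; exact: countable_terms.
apply: (@sub_countable _ _ _ (range j)); last first.
  exact: sub_countable (card_image_le _ _) (countableP _).
apply: subset_card_le => k [[_ [e _ <-]]|]; exact: equation_vars_rename.
Qed.

Lemma variety_quasivariety (V : algebra S -> Prop) : finite_type S ->
  variety V -> quasivariety K V.
Proof.
move=> finS [E VE]; have [j jinj] := uncountable_embedding nat.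
have k0 := j 0.
exists [set q | exists2 e, E e &
  q = Implication (rename_equation k0 j @` set0) (rename_equation k0 j e)].
split=> [_ [e _ ->]|A]; first exact: quasiequation_rename.
split=> [/VE Ae _ [e /Ae eA ->]|H].
  by apply/(valid_implication_rename _ _ _ _ jinj) => v _; exact: eA.
apply/VE => e Ee v; have := H _ (ex_intro2 _ _ e Ee erefl).
by move=> /(valid_implication_rename _ _ _ _ jinj); exact.
Qed.

Context (V : algebra S -> Prop) (finS : finite_type S) (varV : variety V).
Hypothesis completeV : card_structurally_complete K V.

(** K-structural completeness enters here: there are countably many
    equations over [X], so every set of them is small enough to be the
    premises of a K-quasiequation. *)
Lemma valid_implication_free (X : countType) (G : set (equation S X)) g :
  valid_implication (free_algebra_omega V) (Implication G g) ->
  forall A, V A -> valid_implication A (Implication G g).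
Proof.
move=> FG A /completeV VA; have [j jinj] := uncountable_embedding X.
have [j0 _] := uncountable_embedding nat; pose k0 := j0 0.
apply/(valid_implication_rename k0 _ _ _ jinj); move: A VA.
set q := Implication (_ @` G) _ => A VA; apply: (VA (fun B => valid_implication B q)); last first.
  by move=> _ ->; apply/(valid_implication_rename k0 _ _ _ jinj).
exists [set q]; split; first by move=> _ ->; exact: quasiequation_rename.
by move=> B; split=> [Bq _ ->//|]; exact.
Qed.

End Uncountable.

(** The premise [X] excludes an empty set of variables, over which there might
    be no terms. *)
Definition transfers_to_finite (S : signature) (V : algebra S -> Prop) : Prop :=
  forall (X : countType) (U : set_system nat) (A : nat -> algebra S)
    (v : forall n, X -> A n) (g : equation S X),
  X -> Filter U -> (forall n, V (A n)) -> ~ U [set n | satisfies (v n) g] ->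
  exists (E : algebra S) (w : X -> E), [/\ finite_algebra E, V E,
    forall e, U [set n | satisfies (v n) e] -> satisfies w e & ~ satisfies w g].

(** * Transfer from ultraproducts to finite algebras *)
Section Transfer.
Context (S : signature) (V : algebra S -> Prop).

Lemma free_residually_finite X (y : X -> free_algebra_omega V) (g : equation S X) :
  generated_by_finite_algebras V -> ~ satisfies y g ->
  exists (E : algebra S) (w : X -> E), [/\ finite_algebra E, V E,
    forall e, satisfies y e -> satisfies w e & ~ satisfies w g].
Proof.
move=> [C [finC VC]] yg.
pose s (x : X) : term_algebra S 0 := free_repr (y x).
have evaly t : eval y t = free_class V (eval s t).
  have -> : y = (fun x => free_class V (s x)).
    by apply: funext => x; rewrite (free_reprK 0).
  by rewrite -(@eval_hom _ _ (term_algebra S 0) (free_algebra_omega V) _ s t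
    (@hom_free_class S V nat 0)).
have satP e : satisfies y e <-> free_eq V (eval s e.1) (eval s e.2).
  by rewrite /satisfies !evaly; exact: (@free_class_eq S V nat 0 (eval s e.1) (eval s e.2)).
have [E CE [u ug]] : exists2 E, C E & exists u : nat -> E,
    eval u (eval s g.1) <> eval u (eval s g.2).
  apply: contrapT => noE; apply: yg; apply/satP => A /VC VA.
  apply: (VA (fun B => valid_equation B (eval s g.1, eval s g.2))).
    exact: variety_equation.
  move=> E CE u; apply: contrapT => ug; apply: noE; exists E => //; exists u.
  exact: ug.
have VE : V E by apply/VC; exact: variety_generated_self.
exists E, (fun x => eval u (s x)); split=> //.
- exact: finC.
- by move=> e /satP/(_ E VE u); rewrite /satisfies /= !eval_subst.
- by rewrite /satisfies -!(eval_subst u).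
Qed.

(** The equations that are true along [U] form a congruence of the term algebra
    whose quotient, a subalgebra of a reduced product, lies in V and violates
    [g].  So the quasiequation with these premises and conclusion [g] fails in F,
    and a failure in F is visible in a finite algebra. *)
Lemma complete_transfers_to_finite (K : Type) :
  card_lt [set: nat] [set: K] -> finite_type S -> variety V ->
  generated_by_finite_algebras V -> card_structurally_complete K V ->
  transfers_to_finite V.
Proof.
move=> uK finS varV genV comV X U A v g x0 FU VA Ug.
pose T := term_algebra S x0.
pose R (s t : T) := U [set n | eval (v n) s = eval (v n) t].
have cR : congruence R.
  split.
  - by move=> s; apply: filterE.
  - by move=> s t; apply: filterS => n /= ->.
  - by move=> r s t rs st; apply: filterS (filterI rs st) => n [/= -> ->].
  - move=> f a b ab; have := filter_forall FU ab.
    apply: filterS => n abn /=; congr interp; apply: funext => i; exact: abn.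
have VQ : V (quot_algebra R).
  apply: variety_quot => // e Ve s; apply: filterE => n.
  by rewrite /= !eval_subst; exact: Ve.
pose y (x : X) : quot_algebra R := quot_class R (Var x).
have satP e : satisfies y e <-> R e.1 e.2.
  by rewrite /satisfies /y -!(eval_hom _ _ (hom_quot_class cR)) !eval_Var;
     exact: quot_class_eq.
pose G := [set e : equation S X | R e.1 e.2].
have [z [zG zg]] : exists z : X -> free_algebra_omega V,
    (forall e, G e -> satisfies z e) /\ ~ satisfies z g.
  apply: contrapT => noz; apply: Ug; apply/satP.
  apply: (valid_implication_free uK finS comV (G := G) _ VQ); last first.
    by move=> e /= /satP.
  move=> z zG /=; apply: contrapT => zg; apply: noz; exists z; split=> //.
have [E [w [finE VE wz wg]]] := free_residually_finite genV zg.
exists E, w; split=> // e Ue; exact/wz/zG.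
Qed.

End Transfer.

Lemma ultra_choice T (U : set_system T) (Z : finType) (f : T -> Z) :
  UltraFilter U -> exists z, U [set n | f n = z].
Proof.
move=> UU; apply: contrapT => noz.
have : U [set n | forall z, f n <> z].
  apply: filter_forall => z.
  have [Uz|//] := in_ultra_setVsetC [set n | f n = z] UU.
  by case: noz; exists z.
by move=> /filter_ex[n /(_ (f n))].
Qed.

Lemma exists_free_ultrafilter : exists U : set_system nat,
  UltraFilter U /\ forall N, U [set n | N <= n].
Proof.
have [U [UU Uev]] := ultraFilterLemma eventually_filter.
by exists U; split=> // N; apply: Uev; exists N.
Qed.

Lemma finite_pigeonhole T (f : nat -> T) : finite_set [set: T] ->
  exists i j, i < j /\ f i = f j.
Proof.
move=> finT; apply: contrapT => nof.
have finj : injective f.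
  move=> i j fij; have [ij|ji|//] := ltngtP i j; case: nof.
    by exists i, j.
  by exists j, i.
apply: infinite_nat; move: finT; apply: card_le_finite.
have /injfunPex : exists2 g : nat -> T, set_fun [set: nat] [set: T] g & set_inj [set: nat] g.
  by exists f => // i j _ _; exact: finj.
by case=> g; exact: inj_card_le g.
Qed.

Lemma many_elements T N : ~ ([set: T] #<= `I_N) ->
  exists x : nat -> T, {in `I_N &, injective x}.
Proof.
move=> TN; suff : `I_N #<= [set: T].
  have [t0] : inhabited T.
    apply: contrapT => noT; apply: TN; apply: card_le_trans (card_ge0 _ `I_N).
    by apply: subset_card_le => x; case: noT.
  by move=> /(card_le_injection t0)[x [xinj _]]; exists x.
have [/finite_setP[M TM]|/infiniteP natT] := pselect (finite_set [set: T]).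
  move: TN; rewrite (card_le_eql TM) (card_le_eqr TM) !card_le_II.
  by move=> /negP; rewrite -ltnNge; exact: ltnW.
exact: card_le_trans (card_leT _) natT.
Qed.

(** * A bound on the depth of forks *)
Section Bounds.
Context (S : signature) (V : algebra S -> Prop).
Context (m : nat) (J : 'I_m -> term S nat) (jonssonJ : jonsson_terms V J).
Context (Z : finType) (term_of : Z -> term S nat) (steps : enough_steps J term_of).
Hypothesis transferV : transfers_to_finite V.

Local Notation step := (step term_of).
Local Notation translate := (translate term_of).
Local Notation fork := (fork J).
Local Notation is_translation := (is_translation term_of).
Local Notation has_fork := (has_fork J term_of).

Lemma hom_fork (A B : algebra S) (h : A -> B) i (T : bool -> bool -> A) e :
  hom h -> h (fork i T e) = fork i (fun s e => h (T s e)) e.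
Proof. by move=> hh; rewrite /fork (hom_jonsson J _ _ _ _ hh). Qed.

Lemma minimal_fork_depth (A : algebra S) (P : bool -> bool -> A) k l :
  has_fork k P -> ~ has_fork l P -> exists r,
    [/\ l < r, has_fork r P & forall i, i < r -> ~ has_fork i P].
Proof.
move=> Pk Pl; have exP : exists i, `[< has_fork i P >] by exists k; apply/asboolP.
have [r /asboolP Pr rmin] := ex_minnP exP; exists r; split=> //.
  by rewrite ltnNge; apply/negP => rl; apply: Pl; exact: (has_fork_leq steps rl Pr).
by move=> i ir Pi; move: (rmin i (asboolT Pi)); rewrite leqNgt ir.
Qed.

(** For sequences indexed by the number of steps still to be made: step number
    [i - 1] leads from index [i] to index [i - 1]. *)
Fixpoint descend (A : algebra S) (zs : nat -> Z) (par : nat -> nat -> A) i (x : A) : A :=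
  if i is i'.+1 then descend zs par i' (step (zs i') (par i') x) else x.

Lemma hom_descend (A B : algebra S) (h : A -> B) zs par i x : hom h ->
  h (descend zs par i x) = descend zs (fun i j => h (par i j)) i (h x).
Proof.
by move=> hh; elim: i x => //= i IH x; rewrite IH (hom_step term_of _ _ _ hh).
Qed.

Lemma is_translation_descend (A : algebra S) zs (par : nat -> nat -> A) i :
  is_translation i (descend zs par i).
Proof.
elim: i => [|i IH]; first exact: is_translation_id steps _ _.
exact: (is_translation_comp (is_translation_step _ _ _) IH).
Qed.

(** Pairs with a fork of a given depth, bundled with their algebra so that one
    can be chosen for each number. *)
Record minimal_data := MinimalData {
  md_algebra : algebra S;
  md_pairs : bool -> bool -> md_algebra;
  md_depth : nat;
  md_shape : bool -> nat -> Z;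
  md_par : bool -> nat -> nat -> md_algebra;
  md_index : 'I_m
}.

(** Otherwise choose for each n pairs in an algebra of V with a fork of minimal
    depth r > n.  The pairs obtained after r - i steps have forks of depth i but
    of no smaller depth, and this property survives in a finite algebra, where
    the pairs cannot all be different. *)
Lemma bounded_fork_depth : exists k, forall A : algebra S, V A ->
  forall (p q : A) (P : bool -> bool -> A), subdirectly_irreducible p q ->
  (forall s, P s false <> P s true) -> has_fork k P.
Proof.
apply: contrapT => nok.
have /choice[D DP] : forall n, exists D : minimal_data,
    [/\ V (md_algebra D), n < md_depth D,
        forall i, i < md_depth D -> ~ has_fork i (@md_pairs D)
      & let T s e := translate (md_depth D) (md_shape D s) (@md_par D s) (@md_pairs D s e) in
        fork (md_index D) T false <> fork (md_index D) T true].
  move=> n; apply: contrapT => noD; apply: nok; exists n => A VA p q P SI Pne.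
  apply: contrapT => nP; apply: noD.
  have [k Pk] := subdirectly_irreducible_has_fork steps jonssonJ VA SI Pne.
  have [r [nr [zs [par [i Pi]]] rmin]] := minimal_fork_depth Pk nP.
  by exists (MinimalData P r zs par i).
have [U [UU Uge]] := exists_free_ultrafilter.
have FU : Filter U by exact: _.
pose r n := md_depth (D n).
pose X : countType := ((bool * bool * nat) + (bool * nat * nat))%type.
pose pt s e i : X := inl (s, e, i).
pose pr s i j : X := inr (s, i, j).
(* Index [i] counts the remaining steps, so the positions are reversed. *)
pose v n (x : X) : md_algebra (D n) := match x with
  | inl (s, e, i) => translate (r n - i) (md_shape (D n) s) (@md_par (D n) s) (@md_pairs (D n) s e)
  | inr (s, i, j) => @md_par (D n) s (r n - i.+1) j
  end.
have [d Ud] := ultra_choice (fun n => md_index (D n)) UU.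
have /choice[ze Uze] : forall si : bool * nat, exists z,
    U [set n | md_shape (D n) si.1 (r n - si.2.+1) = z].
  by move=> si; exact: ultra_choice.
pose x0 := pt false false 0.
pose T := term_algebra S x0.
pose tpt s e i : T := Var (pt s e i).
pose tpr s i j : T := Var (pr s i j).
pose g : equation S X := (fork d (fun s e => tpt s e 0) false, fork d (fun s e => tpt s e 0) true).
have [|E [w [finE VE wU]]] := transferV (A := fun n => md_algebra (D n)) (v := v)
  (g := g) x0 FU (fun n => let: And4 VA _ _ _ := DP n in VA).
  move=> Ug; have [n [/= nd]] := filter_ex (filterI Ud Ug).
  rewrite /satisfies !(hom_fork _ _ _ (hom_eval (v n))) /= subn0 -nd.
  by have [_ _ _] := DP n.
case; rewrite /satisfies /g /= !(hom_fork _ _ _ (hom_eval w)).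
pose wpr s i j : E := w (pr s i j).
have wstep s e i : w (pt s e i) = step (ze (s, i)) (wpr s i) (w (pt s e i.+1)).
  have /wU : U [set n | satisfies (v n) (tpt s e i, step (ze (s, i)) (tpr s i) (tpt s e i.+1))].
    apply: filterS (filterI (Uge i) (Uze (s, i))) => n [/= ilen nze].
    rewrite /satisfies (hom_step term_of _ _ _ (hom_eval (v n))) /= -nze.
    have [_ nr _ _] := DP n.
    by rewrite -{1}(subnSK (leq_ltn_trans ilen nr)).
  by rewrite /satisfies (hom_step term_of _ _ _ (hom_eval w)).
have wdescend s e i : descend (fun i => ze (s, i)) (wpr s) i (w (pt s e i)) = w (pt s e 0).
  by elim: i => //= i IH; rewrite -wstep.
have [i [j [ij wij]]] : exists i j, i < j /\ forall s e, w (pt s e i) = w (pt s e j).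
  have /(finite_pigeonhole (fun i => ((w (pt false false i), w (pt false true i)),
      (w (pt true false i), w (pt true true i))))) : finite_set [set: (E * E) * (E * E)].
    rewrite -!setXTT; do !apply: finite_setX; exact: finE.
  by move=> [i [j [ij [? ? ? ?]]]]; exists i, j; split=> // -[] [].
pose dt s e : T := descend (fun i => ze (s, i)) (tpr s) i (tpt s e j).
(* From index [j], a descent of only [i < j] steps produces no fork in [A_n],
   for all n >= j. *)
have /wU : U [set n | satisfies (v n) (fork d dt false, fork d dt true)].
  apply: filterS (Uge j) => n /= jn; rewrite /satisfies /= !(hom_fork _ _ _ (hom_eval (v n))).
  have [_ nr rmin _] := DP n; have jr := leq_ltn_trans jn nr.
  apply: contrapT => ne; apply: (rmin (r n - j + i)).
    by rewrite -[X in _ < X](subnK (ltnW jr)) ltn_add2l.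
  apply: (has_fork_translate (zs := md_shape (D n)) (par := @md_par (D n))).
  apply/has_forkP.
  exists (fun s => descend (fun i => ze (s, i)) (fun i j => v n (pr s i j)) i), d.
  split=> [s|]; first exact: is_translation_descend.
  by move: ne; rewrite /fork /dt /= !(hom_descend _ _ _ _ (hom_eval (v n))).
rewrite /satisfies /= !(hom_fork _ _ _ (hom_eval w)) /fork.
by rewrite !(hom_descend _ _ _ _ (hom_eval w)) /= -!wij !wdescend.
Qed.

End Bounds.

(** * A bound on the size of subdirectly irreducible algebras *)
Lemma pair_enumeration : exists e : nat -> nat * nat,
  (forall t, (e t).1 <> (e t).2) /\ forall i j, i <> j -> exists t, e t = (i, j).
Proof.
exists (fun t => if unpickle t is Some (i, j) then
  if i == j then (0, 1) else (i, j) else (0, 1)); split=> [t|i j /eqP ij].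
  by case: unpickle => // -[i j]; case: eqP.
by exists (pickle (i, j)); rewrite pickleK (negPf ij).
Qed.

Section SizeBound.
Context (S : signature) (V : algebra S -> Prop).
Context (m : nat) (J : 'I_m -> term S nat) (jonssonJ : jonsson_terms V J).
Context (Z : finType) (term_of : Z -> term S nat).
Hypothesis transferV : transfers_to_finite V.

Local Notation translate := (translate term_of).
Local Notation fork := (fork J).
Local Notation has_fork := (has_fork J term_of).

Record fork_data (A : algebra S) := ForkData {
  fd_shape : bool -> nat -> Z;
  fd_par : bool -> nat -> nat -> A;
  fd_index : 'I_m
}.

Definition translated_fork (A : algebra S) k (D : fork_data A) (P : bool -> bool -> A) : bool -> A :=
  fork (fd_index D) (fun s e => translate k (fd_shape D s) (fd_par D s) (P s e)).

Lemma eval_translated_fork X (x0 : X) (A : algebra S) (w : X -> A) k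
    (D : fork_data (term_algebra S x0)) P c :
  eval w (translated_fork k D P c) =
  translated_fork k (ForkData (fd_shape D) (fun s i j => eval w (fd_par D s i j)) (fd_index D))
    (fun s e => eval w (P s e)) c.
Proof.
rewrite /translated_fork (hom_fork J _ _ _ (hom_eval w)) /fork.
by rewrite !(hom_translate term_of _ _ _ _ (hom_eval w)).
Qed.

Definition two_pairs (T : Type) (a b : bool -> T) : bool -> bool -> T :=
  fun s => if s then b else a.

Definition pick_pair (T : Type) (x : nat -> T) (ij : nat * nat) : bool -> T :=
  fun e => x (if e then ij.2 else ij.1).

(** The forks are taken downwards, from index [n] to index 0, so that the number
    of forks between the pair of index [t] and the final result is at most
    [t + 1], whatever [n] is. *)
Lemma meet_chain (A : algebra S) k (a : nat -> bool -> A) n :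
  (forall P : bool -> bool -> A, (forall s, P s false <> P s true) -> has_fork k P) ->
  (forall t, t <= n -> a t false <> a t true) ->
  exists (D : nat -> fork_data A) (q : nat -> bool -> A),
    (forall t, t <= n -> q t = translated_fork k (D t) (two_pairs (a t) (q t.+1))) /\
    q 0 false <> q 0 true.
Proof.
move=> forkA ane.
have /choice[N NP] : forall tq : nat * (bool -> A), exists Dq : fork_data A * (bool -> A),
    Dq.2 = translated_fork k Dq.1 (two_pairs (a tq.1) tq.2) /\
    (tq.1 <= n -> tq.2 false <> tq.2 true -> Dq.2 false <> Dq.2 true).
  move=> [t q]; have [a0] := carrier_inhabited A.
  have [P|nP] := pselect (t <= n /\ q false <> q true).
    have [|zs [par [i Pi]]] := forkA (two_pairs (a t) q).
      by case; [exact: P.2|exact: ane P.1].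
    by exists (ForkData zs par i, translated_fork k (ForkData zs par i) (two_pairs (a t) q)).
  have [zs [par [i _]]] := forkA (fun=> a 0) (fun=> ane 0 (leq0n n)).
  exists (ForkData zs par i, translated_fork k (ForkData zs par i) (two_pairs (a t) q)); split=> //.
  by move=> tn qne; case: nP.
(* [qq l] is the pair of index [n.+1 - l]. *)
pose qq := fix qq l := if l is l'.+1 then (N (n - l', qq l')).2 else a 0.
pose q t := qq (n.+1 - t).
have qE t : t <= n -> q t = (N (t, q t.+1)).2.
  by move=> tn; rewrite /q subSS subSn //= subKn.
exists (fun t => (N (t, q t.+1)).1), q; split.
  by move=> t tn; rewrite {1}qE //; have [] := NP (t, q t.+1).
have qqne l : l <= n.+1 -> qq l false <> qq l true.
  elim: l => [_|l IH ln] /=; first exact: ane.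
  have [_] := NP (n - l, qq l); apply; first exact: leq_subr.
  exact: IH (ltnW ln).
exact: qqne.
Qed.

(** The outcome of [meet_chain] with its algebra, to be chosen for each number. *)
Record chain_data := ChainData {
  cd_algebra : algebra S;
  cd_point : nat -> cd_algebra;
  cd_fork : nat -> fork_data cd_algebra;
  cd_pair : nat -> bool -> cd_algebra
}.

(** Otherwise the chains of [meet_chain], built on more and more points, have a
    common finite model in which the final pair is not collapsed.  Going up the
    chain, no pair is collapsed; but two of the infinitely many points coincide,
    and this collapses the fork taken with them. *)
Lemma bounded_size k :
  (forall A : algebra S, V A ->
   forall (p q : A) (P : bool -> bool -> A), subdirectly_irreducible p q ->
   (forall s, P s false <> P s true) -> has_fork k P) ->
  exists N, forall (A : algebra S) (p q : A), V A ->
    subdirectly_irreducible p q -> [set: A] #<= `I_N.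
Proof.
move=> forkV; apply: contrapT => noN.
have [e [ene esurj]] := pair_enumeration.
have /choice[D DP] : forall n, exists D : chain_data,
    [/\ V (cd_algebra D),
        forall t, t <= n -> @cd_pair D t =
          translated_fork k (@cd_fork D t) (two_pairs (pick_pair (@cd_point D) (e t)) (@cd_pair D t.+1))
      & @cd_pair D 0 false <> @cd_pair D 0 true].
  move=> n; pose b := (\max_(t < n.+1) maxn (e t).1 (e t).2).+1.
  apply: contrapT => noD; apply: noN; exists b => A p q VA SI.
  apply: contrapT => /many_elements[x xinj]; apply: noD.
  have [|t tn|F [c [cF c0]]] := @meet_chain A k (fun t => pick_pair x (e t)) n.
  - by move=> P Pne; exact: forkV VA _ _ _ SI Pne.
  - have /(leq_trans _) etb := @leq_bigmax 'I_n.+1 (fun t : 'I_n.+1 => maxn (e t).1 (e t).2)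
      (Ordinal (tn : t < n.+1)).
    move=> /xinj; rewrite !inE /b /= !ltnS => xe; apply: (ene t); apply: xe.
      by apply: etb; exact: leq_maxl.
    by apply: etb; exact: leq_maxr.
  by exists (ChainData x F c).
have [U [UU Uge]] := exists_free_ultrafilter.
have FU : Filter U by exact: _.
pose X : countType := (nat + (nat * bool) + (nat * bool * nat * nat))%type.
pose vx i : X := inl (inl i).
pose vq t c : X := inl (inr (t, c)).
pose vp t s i j : X := inr (t, s, i, j).
pose v n (x : X) : cd_algebra (D n) := match x with
  | inl (inl i) => @cd_point (D n) i
  | inl (inr (t, c)) => @cd_pair (D n) t c
  | inr (t, s, i, j) => fd_par (@cd_fork (D n) t) s i j
  end.
have /choice[d Ud] : forall t, exists d, U [set n | fd_index (@cd_fork (D n) t) = d].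
  by move=> t; exact: ultra_choice.
have /choice[ze Uze] : forall tsi : nat * (bool * nat), exists z,
    U [set n | fd_shape (@cd_fork (D n) tsi.1) tsi.2.1 tsi.2.2 = z].
  by move=> tsi; exact: ultra_choice.
pose x0 := vx 0.
pose T := term_algebra S x0.
have [|E [w [finE VE wU]]] := transferV (A := fun n => cd_algebra (D n)) (v := v)
  (g := (Var (vq 0 false), Var (vq 0 true))) x0 FU (fun n => let: And3 VA _ _ := DP n in VA).
  by move=> /filter_ex[n]; have [_ _] := DP n.
case; rewrite /satisfies /=.
pose F (B : algebra S) (u : X -> B) t : fork_data B :=
  ForkData (fun s i => ze (t, (s, i))) (fun s i j => u (vp t s i j)) (d t).
pose P (B : algebra S) (u : X -> B) t : bool -> bool -> B :=
  two_pairs (pick_pair (fun i => u (vx i)) (e t)) (fun c => u (vq t.+1 c)).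
have evalF (B : algebra S) (u : X -> B) t c :
    eval u (translated_fork k (@F T Var t) (@P T Var t) c) = translated_fork k (F B u t) (P B u t) c.
  by rewrite eval_translated_fork /translated_fork /fork; case: c.
have wq t c : w (vq t c) = translated_fork k (F E w t) (P E w t) c.
  have /wU : U [set n | satisfies (v n) (Var (vq t c), translated_fork k (@F T Var t) (@P T Var t) c)].
    (* Bounded depth: finitely many shapes are fixed at the same time. *)
    have Uz : U [set n | forall si : bool * 'I_k,
        fd_shape (@cd_fork (D n) t) si.1 si.2 = ze (t, (si.1, val si.2))].
      by apply: filter_forall => -[s i]; exact: Uze (t, (s, val i)).
    apply: filterS (filterI (Uge t) (filterI (Ud t) Uz)) => n [/= tn [nd nz]].
    rewrite /satisfies evalF /=; have [_ qE _] := DP n.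
    have run_ext h : translate k (fd_shape (@cd_fork (D n) t) h) (fd_par (@cd_fork (D n) t) h) =
        translate k (fun i => ze (t, (h, i))) (fun i j => v n (vp t h i j)).
      apply: funext => x; apply: translate_ext => // i ik.
      exact: nz (h, Ordinal ik).
    rewrite (qE t tn) /translated_fork /= nd; congr (fork (d t) _ c).
    by apply: funext => s; apply: funext => c'; rewrite run_ext; case: s.
  by rewrite /satisfies evalF.
apply: contrapT => w0.
have wne t : w (vq t false) <> w (vq t true).
  elim: t => // t IH qt; apply: IH; rewrite !wq.
  by apply: (fork_collapse jonssonJ _ (s := true)) => //=; rewrite qt.
have [i [j [ij xij]]] := finite_pigeonhole (fun i => w (vx i)) finE.
have [t et] : exists t, e t = (i, j).
  by apply: esurj => ij'; move: ij; rewrite ij' ltnn.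
apply: (wne t); rewrite !wq; apply: (fork_collapse jonssonJ _ (s := false)) => //=.
by rewrite /pick_pair et xij.
Qed.

End SizeBound.

(** * A finite generating algebra *)
Lemma finite_injection T (I : finType) (f : T -> I) : injective f ->
  finite_set [set: T].
Proof.
move=> finj; have : finite_set [set: I] by exact: finite_finset.
apply: card_le_finite.
have /injfunPex[g] : exists2 g : T -> I, set_fun [set: T] [set: I] g & set_inj [set: T] g.
  by exists f => // x y _ _; exact: finj.
exact: inj_card_le g.
Qed.

Lemma small_set_retract T n : [set: T] #<= `I_n.+1 ->
  inhabited T -> exists (f : T -> 'I_n.+1) (r : 'I_n.+1 -> T), cancel f r.
Proof.
move=> /(card_le_injection 0)[f [finj fn]] [t0].
exists (fun x => Ordinal (fn x I)).
exists (fun k => if pselect (exists x, f x = k) is left H then projT1 (cid H) else t0).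
move=> x /=; case: pselect => [H|[]]; last by exists x.
by case: cid => /= y /finj; rewrite !inE; exact.
Qed.

Section Tabular.
Context (S : signature).

(** Every algebra with at most N + 1 elements is an image of an algebra on
    ['I_N.+1] whose operations are given by one finite table.  Such an algebra
    need not satisfy the equations of the class, but it determines the values of
    terms, and there are finitely many tables. *)
Section Tables.
Context (I : finType) (sym : I -> symbol S) (symP : forall f, exists i, sym i = f).
Context (N : nat).

Let code f := projT1 (cid (symP f)).
Let codeK f : sym (code f) = f := projT2 (cid (symP f)).
Let M := \max_(i : I) arity (sym i).
Let table := {ffun I * {ffun 'I_M.+1 -> 'I_N.+1} -> 'I_N.+1}.

(** Tuples of all arities are padded to one common length. *)
Let pad n (a : 'I_n -> 'I_N.+1) : {ffun 'I_M.+1 -> 'I_N.+1} :=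
  [ffun l : 'I_M.+1 => if insub (val l) is Some i then a i else ord0].

Definition table_algebra (o : table) : algebra S :=
  @Algebra S 'I_N.+1 (fun f a => o (code f, pad a)) (inhabits ord0).

Lemma table_cover (B : algebra S) (b : B -> 'I_N.+1) (r : 'I_N.+1 -> B) :
  cancel b r -> exists o, @hom S (table_algebra o) B r.
Proof.
move=> bK.
exists [ffun ia : I * {ffun 'I_M.+1 -> 'I_N.+1} =>
  b (interp (fun j : 'I_(arity (sym ia.1)) => r (ia.2 (inord j))))] => f a.
rewrite /= ffunE bK /=.
have gen g : arity g <= M -> g = f ->
    interp (fun j : 'I_(arity g) => r (pad a (inord j))) = interp (fun i => r (a i)).
  move=> gM gf; subst g; congr interp; apply: funext => i.
  have iM : i < M.+1 by rewrite ltnS; apply: leq_trans gM; exact: ltnW.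
  rewrite /pad ffunE /= inordK // insubT //= => iL.
  by congr (r (a _)); apply: val_inj.
apply: gen (codeK f).
exact: (@leq_bigmax I (fun i => arity (sym i)) (code f)).
Qed.

End Tables.

(** An element is determined by the values of a representing term in all table
    algebras under all valuations. *)
Lemma finite_free_algebra (W : algebra S -> Prop) N : finite_type S ->
  (forall B, W B -> [set: B] #<= `I_N.+1) ->
  finite_algebra (free_algebra W (inhabits (@ord0 N))).
Proof.
move=> /finite_setT_surjection[I [sym symP]] WN.
pose ev (p : free_carrier W 'I_N.+1) := [ffun ov : _ * {ffun 'I_N.+1 -> 'I_N.+1} =>
  @eval S 'I_N.+1 (table_algebra symP ov.1) ov.2 (free_repr p) : 'I_N.+1].
apply: (@finite_injection _ _ ev) => p q pq.
rewrite -(free_reprK ord0 p) -(free_reprK ord0 q); apply/(free_class_eq _ ord0).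
move=> B WB u; have [b [r bK]] := small_set_retract (WN B WB) (carrier_inhabited B).
have [o or] := table_cover symP bK.
have -> : u = (fun x => r ([ffun x => b (u x)] x)).
  by apply: funext => x; rewrite ffunE bK.
rewrite /satisfies /= -!(@eval_hom S _ (table_algebra symP o) B r _ _ or).
by move/ffunP: pq => /(_ (o, [ffun x => b (u x)])); rewrite !ffunE => ->.
Qed.

(** The generator is free on N + 1 elements for the members with at most N + 1
    elements.  Each of these is its quotient, and an equation failing in V
    fails in a subdirectly irreducible member, which has this size. *)
Lemma bounded_size_tabular (V : algebra S -> Prop) : finite_type S -> variety V ->
  (exists N, forall (A : algebra S) (p q : A), V A ->
    subdirectly_irreducible p q -> [set: A] #<= `I_N) ->
  tabular V.
Proof.
move=> finS varV [N VN].
pose W (B : algebra S) := V B /\ [set: B] #<= `I_N.+1.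
pose A := free_algebra W (inhabits (@ord0 N)).
have VA : V A by apply: variety_free_algebra => // B [].
exists A; split; first by apply: finite_free_algebra => // B [].
move=> B; split=> [VB U [E UE] AU|]; last by apply=> // _ ->.
have /UE UA : U A by exact: AU.
apply/UE => e Ee v; apply: contrapT => ve.
have [R [cR SI]] := subdirectly_irreducible_quotient ve.
have VQ : V (quot_algebra R) by exact: variety_quot_member.
have QN : [set: quot_algebra R] #<= `I_N.+1.
  apply: card_le_trans (VN _ _ _ VQ SI) _.
  by rewrite card_le_II.
have [b [r bK]] := small_set_retract QN (carrier_inhabited (quot_algebra R)).
pose u n := quot_class R (v n); pose s n : term_algebra S (@ord0 N) := Var (b (u n)).
case: SI; rewrite !(eval_hom _ _ (hom_quot_class cR)); case.
have := UA e Ee (fun n => free_class W (s n)); rewrite /satisfies.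
have hF := @hom_free_class S W _ (@ord0 N).
rewrite -!(@eval_hom _ _ (term_algebra S (@ord0 N)) A _ s _ hF).
move=> /(free_class_eq _ ord0)/(_ _ (conj VQ QN) r).
rewrite /satisfies /= !eval_subst /=.
by under eq_fun do rewrite bK.
Qed.

End Tabular.

(** * Tabular varieties *)
Lemma finite_functions n T : finite_set [set: T] -> finite_set [set: 'I_n -> T].
Proof.
move=> /finite_setT_surjection[I [c cP]].
suff -> : [set: 'I_n -> T] = range (fun g : {ffun 'I_n -> I} => fun i => c (g i)).
  by apply: finite_image; exact: finite_finset.
apply/seteqP; split=> // a _; have /choice[g ga] i := cP (a i).
by exists (finfun g) => //; apply: funext => i; rewrite ffunE.
Qed.

Lemma finite_card_lt_nat T (A : set T) : finite_set A -> card_lt A [set: nat].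
Proof.
by move=> finA; split; [exact: finite_set_countable|exact/finite_setPn].
Qed.

Section Diagrams.
Context (S : signature) (V : algebra S -> Prop) (finS : finite_type S).

Definition diagram (E : algebra S) : set (equation S E) :=
  \bigcup_(f in [set: symbol S])
    range (fun a : 'I_(arity f) -> E => (App f (fun i => Var (a i)), Var (interp a))).

Lemma diagram_hom (E A : algebra S) (h : E -> A) :
  (forall e, diagram e -> satisfies h e) -> hom h.
Proof.
move=> hE f a; apply/esym.
by apply: (hE (App f (fun i => Var (a i)), Var (interp a))); exists f => //; exists a.
Qed.

(** The diagram of a finite algebra of finite type is a finite set of equations.
    If every homomorphism into F identified p and q, then the quasiequation
    from the diagram to p = q would hold in F, hence in E. *)
Lemma finite_member_separated (E : algebra S) (p q : E) :
  structurally_complete V -> finite_algebra E -> V E -> p <> q ->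
  exists h : E -> free_algebra_omega V, hom h /\ h p <> h q.
Proof.
move=> scV finE /scV VE pq.
have /countable_injP[j /in2TT jinj] : countable [set: E] by exact: finite_set_countable.
apply: contrapT => noh; apply: pq.
pose qd := Implication (rename_equation 0 j @` @diagram E)
  (rename_equation 0 j (Var p, Var q)).
have qdP A : valid_implication A qd <-> valid_implication A (Implication (@diagram E) (Var p, Var q)).
  exact: valid_implication_rename.
suff /qdP /(_ id) : valid_implication E qd.
  by apply=> e /= [f _ [a _ <-]].
apply: (VE (fun A => valid_implication A qd)); last first.
  move=> _ ->; apply/qdP => h /diagram_hom hh; apply: contrapT => hpq.
  by apply: noh; exists h.
exists [set qd]; split=> [_ ->|A]; last by split=> [Aq _ ->//|]; exact.
split; apply: finite_card_lt_nat => /=.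
  apply: finite_image; apply: bigcup_finite => // f _; apply: finite_image.
  exact: finite_functions.
apply: (@sub_finite_set _ _ (range j)); last exact: finite_image.
move=> n [[_ [e _ <-]]|]; exact: equation_vars_rename.
Qed.

End Diagrams.

Section FinitelyGenerated.
Context (S : signature) (V : algebra S -> Prop).
Context (m : nat) (J : 'I_m -> term S nat) (jonssonJ : jonsson_terms V J).
Context (Z : finType) (term_of : Z -> term S nat) (steps : enough_steps J term_of).

(** In an infinite E choose more than |A| elements.  Fork after fork,
    one builds two terms with different values in E which every valuation in A
    makes equal as soon as it identifies one of finitely many given pairs of
    these elements.  By the pigeonhole principle every valuation in A does so
    when all pairs are taken; hence the terms give an equation of A failing
    in E. *)
Lemma tabular_finite_irreducible (A E : algebra S) (p q : E) :
  finite_algebra A -> same_class V (variety_generated (singleton_class A)) ->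
  V E -> subdirectly_irreducible p q -> finite_algebra E.
Proof.
move=> finA VA VE SI; apply: contrapT => /infiniteP.
move=> /(card_le_injection p)[c [cinj _]].
have /finite_set_leP[N /(card_le_injection 0)[code [codeinj codeN]]] := finA.
have VAA : V A by apply/VA; exact: variety_generated_self.
pose T := term_algebra S p.
have collapse (L : seq (nat * nat)) : all (fun ij => ij.1 != ij.2) L ->
    exists s t : T, eval (A := E) id s <> eval id t /\
    forall w : E -> A, (exists2 ij, ij \in L & w (c ij.1) = w (c ij.2)) ->
      eval w s = eval w t.
  elim: L => [_|[i j] L IH /= /andP[ij /IH[s [t [st stL]]]]].
    by exists (Var p), (Var q); split=> [|w []//]; case: SI.
  pose P : bool -> bool -> T :=
    two_pairs (fun e => if e then t else s) (fun e => Var (c (if e then j else i))).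
  have [|k [zs [par [i' Pi]]]] := @subdirectly_irreducible_has_fork S m J Z term_of steps V jonssonJ
      E p q (fun s e => eval id (P s e)) VE SI.
    case=> //= /cinj; rewrite !inE => /(_ I I) /eqP.
    by rewrite (negPf ij).
  pose D : fork_data m Z T := ForkData (A := T) zs (fun s i j => Var (par s i j)) i'.
  exists (translated_fork J term_of k D P false), (translated_fork J term_of k D P true).
  split=> [|w [ij']]; first by rewrite !(eval_translated_fork J term_of).
  rewrite !(eval_translated_fork J term_of) inE => /orP[/eqP->/= wij|ij'L wij'].
    by apply: (fork_collapse jonssonJ _ (s := true)); rewrite //= wij.
  apply: (fork_collapse jonssonJ _ (s := false)); rewrite //= stL //.
  by exists ij'.
pose L := [seq ij <- [seq (i, j) | i <- iota 0 N.+1, j <- iota 0 N.+1] | ij.1 != ij.2].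
have [s [t [st stL]]] := collapse L (filter_all _ _).
apply: st; apply: (@valid_equation_generated S E (singleton_class A) (s, t) E _ ((VA E).1 VE) id).
move=> _ -> w; apply: stL.
(* [A] has at most [N] elements, so two of the first [N + 1] points coincide. *)
pose g (i : 'I_N.+1) : 'I_N := Ordinal (codeN (w (c i)) I).
have /injectivePn[i [j ij gij]] : ~~ injectiveb g.
  by apply/negP => /injectiveP /leq_card; rewrite !card_ord ltnn.
exists (val i, val j).
  rewrite mem_filter; apply/andP; split; first exact: ij.
  by apply: allpairs_f; rewrite mem_iota ltn_ord.
by apply: codeinj; rewrite ?inE //; have := congr1 val gij.
Qed.

End FinitelyGenerated.

(** A failure of an implication in a member of V is a pair p <> q, which remains
    separated in a subdirectly irreducible quotient; that quotient is finite,
    and a homomorphism into F carries the failure to F. *)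
Lemma tabular_complete (S : signature) (V : algebra S -> Prop) (K : Type) :
  finite_type S -> variety V -> congruence_distributive V ->
  structurally_complete V -> card_lt [set: nat] [set: K] -> tabular V ->
  card_structurally_complete K V.
Proof.
move=> finS varV cdV scV uK [A [finA VA]].
have [m [J jonssonJ]] := exists_jonsson_terms varV cdV.
have [Z [term_of steps]] := exists_enough_steps J finS.
move=> B; split=> [VB Q [Phi [_ QPhi]] FQ|]; last first.
  move=> /(_ _ (variety_quasivariety uK finS varV)); apply=> _ ->.
  exact: variety_free_algebra.
apply/QPhi => qi Phiq v vprem; apply: contrapT => vconcl.
have [R [cR SI]] := subdirectly_irreducible_quotient vconcl.
have VE : V (quot_algebra R) by exact: variety_quot_member.
have finE := tabular_finite_irreducible jonssonJ steps finA VA VE SI.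
have [h [hh hpq]] := finite_member_separated finS scV finE VE (proj1 SI).
have ev t : eval (fun x => h (quot_class R (v x))) t = h (quot_class R (eval v t)).
  by rewrite (eval_hom _ _ (hom_quot_class cR)) (eval_hom _ _ hh).
have /QPhi /(_ qi Phiq) : Q (free_algebra_omega V) by exact: FQ.
move=> /(_ (fun x => h (quot_class R (v x)))) Fq; apply: hpq.
rewrite -!ev; apply: Fq => e /vprem.
by rewrite /satisfies !ev => ->.
Qed.

Theorem theorem3p2 (S : signature) (V : algebra S -> Prop) (K : Type)
    (hfin : finite_type S)
    (hvar : variety V)
    (hcd : congruence_distributive V)
    (hgen : generated_by_finite_algebras V)
    (hsc : structurally_complete V)
    (hreg : regular_cardinal K)
    (huncountable : card_lt (@setT nat) (@setT K)) :
  card_structurally_complete K V <-> tabular V.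
Proof.
split; last exact: tabular_complete.
move=> hcomplete.
have transferV := complete_transfers_to_finite huncountable hfin hvar hgen hcomplete.
have [m [J jonssonJ]] := exists_jonsson_terms hvar hcd.
have [Z [term_of steps]] := exists_enough_steps J hfin.
have [k forkV] := bounded_fork_depth jonssonJ steps transferV.
apply: bounded_size_tabular => //.
exact: (bounded_size jonssonJ transferV forkV).
Qed.
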